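(* Let $A_0\ge 1$ and $A_1\ge 1$. There exist constants $\delta\in(0,1)$, $a_0\in(0,1)$, $\eta>0$, $C_1<\infty$, $C_2<\infty$ and $N_0\in\mathbb{N}$, depending only on $A_0$ and $A_1$, such that for every space of homogeneous type $(X,\rho,\mu)$ with quasi-triangle constant $A_0$ and doubling constant $A_1$, and for every admissible choice of centers $(Z_k)_{k\in\mathbb{Z}}$ and partial order $\preceq$ (for this $\delta$), the family $\mathcal{D}$ of dyadic cubes $Q^k_\alpha$ (with parameters $\delta,a_0$) satisfies: (a) Each $Q^k_\alpha\in\mathcal{D}$ is open. (b) Each $Q^k_\alpha\in\mathcal{D}$ contains the ball $B(z^k_\alpha,a_0\delta^k)$. (c) For each $Q^k_\alpha\in\mathcal{D}$, $\operatorname{diam}(Q^k_\alpha)\le C_1\delta^k$. (d) For each $Q^k_\alpha\in\mathcal{D}$ and $l<k$ there exists a unique $\beta\in I_l$ such that $Q^k_\alpha\subset Q^l_\beta$. (e) If $l\ge k$ and $\alpha\in I_k$, $\beta\in I_l$, then either $Q^l_\beta\subset Q^k_\alpha$ or $Q^l_\beta\cap Q^k_\alpha=\varnothing$. (f) For each $Q^k_\alpha\in\mathcal{D}$, $\#\{Q^{k+1}_\beta\in\mathcal{D}_{k+1}: Q^{k+1}_\beta\subset Q^k_\alpha\}\le N_0$. (g) For each $k\in\mathbb{Z}$, $\mu\big(X\setminus\bigcup_{\alpha\in I_k}Q^k_\alpha\big)=0$. (h) For each $Q^k_\alpha\in\mathcal{D}$ and each $t>0$, $$\mu\big(\{x\in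 Q^k_\alpha:\rho(x,X\setminus\overline{Q^k_\alpha})\le t\delta^k\}\big)\le C_2t^\eta\mu(Q^k_\alpha),$$ where $\overline{Q^k_\alpha}$ is the closure of $Q^k_\alpha$.
   Context: A quasi-metric on a set $X$ is a function $\rho:X\times X\to[0,\infty)$ such that for all $x,y,z\in X$: $\rho(x,y)=0$ iff $x=y$; $\rho(x,y)=\rho(y,x)$; $\rho(x,z)\le A_0\rho(x,y)+A_0\rho(y,z)$, where $A_0\ge1$ is a constant (the quasi-triangle constant). Put $B(x,r)=\{y\in X:\rho(x,y)<r\}$ for $r>0$, $\operatorname{diam}(A)=\sup_{x,y\in A}\rho(x,y)$, $\rho(x,A)=\inf_{y\in A}\rho(x,y)$, with $\inf\varnothing=\infty$. Topological notions refer to the topology in which $U\subset X$ is open iff for each $x\in U$ there is $r>0$ with $B(x,r)\subset U$. A doubling measure on $(X,\rho)$ is a Borel regular measure $\mu$ such that all balls are $\mu$-measurable and, for all $x\in X$, $r>0$, $0<\mu(B(x,r))<\infty$ and $\mu(B(x,2r))\le A_1\mu(B(x,r))$, where $A_1\ge1$ is a constant (the doubling constant). A space of homogeneous type is a triple $(X,\rho,\mu)$ with $X$ a non-empty set, $\rho$ a quasi-metric on $X$ such that all balls are open sets, and $\mu$ a doubling measure on $(X,\rho)$. Let $\delta,a_0\in(0,1)$. An admissible choice of centers and partial order consists of: (1) for each $k\in\mathbb{Z}$, a subset $Z_k=\{z^k_\alpha:\alpha\in I_k\}\subset X$ (injectively indexed by $I_k$) that is maximal with respect to the property $\rho(z^k_\alpha,z^k_\beta)\ge\delta^k$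 for all distinct $z^k_\alpha,z^k_\beta\in Z_k$; (2) a partial order $\preceq$ on $\{(k,\alpha):k\in\mathbb{Z},\alpha\in I_k\}$ such that (i) $(k,\alpha)\preceq(l,\beta)$ implies $k\ge l$; (ii) for each $(k,\alpha)$ and $l\le k$ there is a unique $\beta\in I_l$ with $(k,\alpha)\preceq(l,\beta)$; (iii) $(k,\alpha)\preceq(k-1,\beta)$ implies $\rho(z^k_\alpha,z^{k-1}_\beta)<\delta^{k-1}$; (iv) $\rho(z^k_\alpha,z^{k-1}_\beta)<\frac{1}{2A_0}\delta^{k-1}$ implies $(k,\alpha)\preceq(k-1,\beta)$. The dyadic cube of generation $k\in\mathbb{Z}$ with index $\alpha\in I_k$ is $Q^k_\alpha=\bigcup_{(l,\beta)\preceq(k,\alpha)}B(z^l_\beta,a_0\delta^l)$. Put $\mathcal{D}_k=\{Q^k_\alpha:\alpha\in I_k\}$ and $\mathcal{D}=\bigcup_{k\in\mathbb{Z}}\mathcal{D}_k$. *)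

(* Defs.v *)
From HB Require Import structures.
From mathcomp Require Import all_boot all_order all_algebra.
From mathcomp Require Import all_classical all_reals all_analysis.

Set Implicit Arguments.
Unset Strict Implicit.
Unset Printing Implicit Defensive.
Import Order.TTheory GRing.Theory Num.Theory.

Local Open Scope classical_set_scope.
Local Open Scope ring_scope.

Record quasi_metric (R : realType) (X : Type) (A0 : R) (rho : X -> X -> R) :
    Prop := QuasiMetric {
  qm_ge0 : forall x y, 0 <= rho x y ;
  qm_eq0 : forall x y, rho x y = 0 <-> x = y ;
  qm_sym : forall x y, rho x y = rho y x ;
  qm_triangle : forall x y z, rho x z <= A0 * rho x y + A0 * rho y z }.

Definition qball (R : realType) (X : Type) (rho : X -> X -> R) (x : X) (r : R) :
  set X := [set y | rho x y < r].

Definition qdiam (R : realType) (X : Type) (rho : X -> X -> R) (A : set X) :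
  \bar R := ereal_sup [set (rho x y)%:E | x in A & y in A].

(* +oo when A is empty *)
Definition qdist (R : realType) (X : Type) (rho : X -> X -> R) (x : X)
  (A : set X) : \bar R := ereal_inf [set (rho x y)%:E | y in A].

Definition qopen (R : realType) (X : Type) (rho : X -> X -> R) (U : set X) :
    Prop :=
  forall x, U x -> exists2 r : R, 0 < r & qball rho x r `<=` U.

(* A copy of X, carrying the topology whose open sets are those satisfying
   [qopen rho]. The axioms of a topology hold for an arbitrary rho; balls need
   not be open. *)
Definition qtop (R : realType) (X : choiceType) (rho : X -> X -> R) : Type := X.

Section qtop_topology.
Variables (R : realType) (X : choiceType) (rho : X -> X -> R).

HB.instance Definition _ := Choice.on (qtop rho).

Let qopenT : qopen rho setT.
Proof. by move=> x _; exists 1 => //; exact: ltr01. Qed.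

Let qopenI : setI_closed (qopen rho).
Proof.
move=> U V oU oV x [Ux Vx].
have [r r0 rU] := oU _ Ux; have [s s0 sV] := oV _ Vx.
exists (Num.min r s) => [|y]; first by rewrite lt_min r0 s0.
by rewrite /qball /= lt_min => /andP[yr ys]; split; [exact: rU|exact: sV].
Qed.

Let qopen_bigU (I : Type) (f : I -> set X) :
  (forall i, qopen rho (f i)) -> qopen rho (\bigcup_i f i).
Proof.
move=> of_ x [i _ fix_]; have [r r0 rf] := of_ i _ fix_.
by exists r => // y yr; exists i => //; exact: rf.
Qed.

HB.instance Definition _ :=
  @isOpenTopological.Build (qtop rho) (qopen rho) qopenT qopenI qopen_bigU.

End qtop_topology.

Lemma qtop_openE (R : realType) (X : choiceType) (rho : X -> X -> R)
  (U : set X) : @open (qtop rho) U = qopen rho U.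
Proof. by []. Qed.

Definition qborel (R : realType) (X : choiceType) (rho : X -> X -> R) :
  set (set X) := <<s @open (qtop rho) >>.

Definition qclosure (R : realType) (X : choiceType) (rho : X -> X -> R)
  (A : set X) : set X := @closure (qtop rho) A.

(* As usual for Borel regularity, mu is defined on all subsets of X, and
   mu-measurability is Caratheodory's. *)
Record borel_regular (R : realType) (X : choiceType) (rho : X -> X -> R)
    (mu : {outer_measure set X -> \bar R}) : Prop := BorelRegular {
  borel_measurable : forall B, qborel rho B -> mu.-caratheodory B ;
  borel_hull : forall A : set X,
    exists B, [/\ qborel rho B, A `<=` B & mu B = mu A] }.

Record doubling_measure (R : realType) (X : choiceType) (A1 : R)
    (rho : X -> X -> R) (mu : {outer_measure set X -> \bar R}) : Prop :=
  DoublingMeasure {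
  dm_borel_regular : borel_regular rho mu ;
  dm_ball_measurable : forall x r, 0 < r -> mu.-caratheodory (qball rho x r) ;
  dm_ball_gt0 : forall x r, 0 < r -> (0 < mu (qball rho x r))%E ;
  dm_ball_lty : forall x r, 0 < r -> (mu (qball rho x r) < +oo)%E ;
  dm_doubling : forall x r, 0 < r ->
    (mu (qball rho x (2 * r)) <= A1%:E * mu (qball rho x r))%E }.

Record homogeneous_type (R : realType) (X : choiceType) (A0 A1 : R)
    (rho : X -> X -> R) (mu : {outer_measure set X -> \bar R}) : Prop :=
  HomogeneousType {
  ht_nonempty : [set: X] !=set0 ;
  ht_quasi_metric : quasi_metric A0 rho ;
  ht_ball_open : forall x r, 0 < r -> @open (qtop rho) (qball rho x r) ;
  ht_doubling : doubling_measure A1 rho mu }.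

Definition separated (R : realType) (X : Type) (rho : X -> X -> R) (r : R)
    (A : set X) : Prop :=
  forall x y, A x -> A y -> x <> y -> r <= rho x y.

Definition maximal_separated (R : realType) (X : Type) (rho : X -> X -> R)
    (r : R) (A : set X) : Prop :=
  separated rho r A /\
  forall B, A `<=` B -> separated rho r B -> B = A.

(* The pair (k, alpha) is [existT I k alpha]. *)
Record admissible (R : realType) (X : Type) (A0 delta : R) (rho : X -> X -> R)
    (I : int -> Type) (z : forall k, I k -> X) (le : rel {k : int & I k}) :
    Prop := Admissible {
  adm_inj : forall k, injective (z k) ;
  adm_maximal : forall k, maximal_separated rho (delta ^ k) (range (z k)) ;
  adm_refl : reflexive le ;
  adm_anti : antisymmetric le ;
  adm_trans : transitive le ;
  adm_generation : forall k l (a : I k) (b : I l),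
    le (existT I k a) (existT I l b) -> l <= k ;
  adm_ancestor : forall k l (a : I k), l <= k ->
    exists! b : I l, le (existT I k a) (existT I l b) ;
  adm_parent_near : forall k (a : I k) (b : I (k - 1)),
    le (existT I k a) (existT I (k - 1) b) ->
    rho (z k a) (z (k - 1) b) < delta ^ (k - 1) ;
  adm_near_parent : forall k (a : I k) (b : I (k - 1)),
    rho (z k a) (z (k - 1) b) < (2 * A0)^-1 * delta ^ (k - 1) ->
    le (existT I k a) (existT I (k - 1) b) }.

Definition dyadic_cube (R : realType) (X : Type) (delta a0 : R)
    (rho : X -> X -> R) (I : int -> Type) (z : forall k, I k -> X)
    (le : rel {k : int & I k}) (k : int) (a : I k) : set X :=
  \bigcup_(p in [set p | le p (existT I k a)])
    qball rho (z (tag p) (tagged p)) (a0 * delta ^ tag p).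

(* Main.v *)
Require Import Defs.
From HB Require Import structures.
From mathcomp Require Import all_boot all_order all_algebra.
From mathcomp Require Import all_classical all_reals all_analysis.
From mathcomp Require Import finmap ring lra.

Set Implicit Arguments.
Unset Strict Implicit.
Unset Printing Implicit Defensive.
Import Order.TTheory GRing.Theory Num.Theory.
Import numFieldNormedType.Exports.

Local Open Scope classical_set_scope.
Local Open Scope ring_scope.

(** The cubes form a tree because the core balls, of radius [a0 * delta ^ k]
    about the centres of generation [k], are tiny next to the separation
    [delta ^ k] of these centres. If core balls of two generations meet, the
    chain of ancestors of the finer centre passes so close to the coarser one
    that the parent rule for near centres puts the finer index below the coarser
    ([core_meet]). As every index has exactly one ancestor in each earlier
    generation, two cubes that meet are comparable
    ([cube_meet]); this gives the nesting, the uniqueness of the parent cube and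
    the disjointness inside a generation. A cube lies in a fixed dilate of its
    core ball since distances along a chain of parents form a geometric series
    ([prec_near]). Doubling then makes every child carry at least the fraction
    [1 / K] of the measure of its parent, with [K = A1 ^ p] ([child_measure]),
    and so a cube has at most [K] children ([packing_card_le]).

    The complement [E] of the cubes of one generation is porous. In a bounded
    part [D] of [E], every point is within [delta ^ m] of a centre of generation
    [m], whose core ball misses [E]. So [mu D] is at most [K] times the measure
    of the points outside [E] within about [delta ^ m] of [D]; as [E] is closed,
    these sets decrease to the empty set when [m] grows, and [mu D = 0]
    ([uncovered_bounded_null]).

    For the boundary layer, let [r] be the width. Each cube [Q] has a child [G]
    whose centre is so close to that of [Q] that [G] sits deep inside the core
    ball of [Q], and the layer of width [r] of [Q] misses [G] as long as [r] is
    at most a small multiple of the size of [Q] ([central_child]). The rest of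
    the layer is, up to a null set, contained in the layers of the same width
    [r] of the other children, whose total measure is at most
    [(1 - 1 / K) * mu Q]. Repeating this over the generations whose size exceeds
    a multiple of [r] multiplies the measure by a factor [theta < 1] each time
    ([layer_decay]). The number of these generations is about
    [ln r / ln delta], and so the product is a power of [r]
    ([exponent_of_ratio]). *)

(** * Elementary estimates *)

Lemma exists_expr_lt (R : realType) (x C r : R) : 0 < x -> x < 1 -> 0 < r ->
  exists n, C * x ^+ n < r.
Proof.
move=> x0 x1 r0.
have /(cvg_geometric C)/cvgr_lt/(_ r r0)[n _ nr] : `|x| < 1.
  by rewrite gtr0_norm.
by exists n; exact: nr (leqnn n).
Qed.

Lemma exists_pow2_ge (R : realType) (C r : R) : 0 < r ->
  exists n, C <= 2 ^+ n * r.
Proof.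
move=> r0; have h2 : (2^-1 : R) < 1 by rewrite invf_lt1 ?ltr1n.
have h0 : (0 : R) < 2^-1 by rewrite invr_gt0.
have [n] := @exists_expr_lt R 2^-1 C r h0 h2 r0.
by rewrite exprVn ltr_pdivrMr ?exprn_gt0// => /ltW; exists n; rewrite mulrC.
Qed.

Lemma int_le_add (k l : int) : k <= l -> exists n : nat, l = k + n%:Z.
Proof.
by move=> kl; exists `|l - k|%N; rewrite gez0_abs ?subr_ge0// subrKC.
Qed.

(** The exponent is the one for which [theta = delta `^ eta]. *)
Lemma exponent_of_ratio (R : realType) (delta theta : R) :
  0 < delta -> delta < 1 -> 0 < theta -> theta < 1 ->
  exists2 eta : R, 0 < eta &
    forall n x, delta ^+ n <= x -> theta ^+ n <= x `^ eta.
Proof.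
move=> d0 d1 t0 t1.
have ld : ln delta < 0 by rewrite ln_lt0// d0.
pose eta := ln theta / ln delta.
have eta0 : 0 < eta by rewrite ltr_ndivlMr// mul0r ln_lt0// t0.
have thetaE : theta = delta `^ eta.
  by rewrite /powR gt_eqF// divfK ?lt_eqF// lnK.
exists eta => // n x dx; rewrite thetaE.
rewrite -powR_mulrn ?powR_ge0// powRAC powR_mulrn; last exact: ltW.
have dn0 : 0 <= delta ^+ n by rewrite exprn_ge0// ltW.
have x0 : 0 <= x := le_trans dn0 dx.
by rewrite ge0_ler_powR ?nnegrE ?(ltW eta0).
Qed.

(** * Outer measures *)

Lemma finite_set_uniq_seq (T : choiceType) (S : set T) : finite_set S ->
  exists2 s : seq T, uniq s & S = [set` s].
Proof.
by move=> fS; exists (fset_set S); [exact: fset_uniq|rewrite fset_setK].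
Qed.

Section OuterMeasure.
Variables (R : realType) (X : choiceType).
Variable mu : {outer_measure set X -> \bar R}.

(** The pieces are cut off one at a time: the Caratheodory condition of a piece is
    tested on what is left of [A]. *)
Lemma sum_outer_le (T : eqType) (s : seq T) (B : T -> set X) (A : set X) :
  uniq s -> {in s, forall i, mu.-caratheodory (B i)} ->
  {in s, forall i, B i `<=` A} ->
  {in s &, forall i j, i <> j -> B i `&` B j = set0} ->
  (\sum_(i <- s) mu (B i) <= mu A)%E.
Proof.
elim: s A => [|i s ih] A /=; first by rewrite big_nil outer_measure_ge0.
move=> /andP[i_s us] mB BA dB; rewrite big_cons.
have is_ : i \in i :: s by rewrite mem_head.
have ss j : j \in s -> j \in i :: s by rewrite inE => ->; rewrite orbT.
rewrite (mB i is_ A) leeD//.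
  by apply: le_outer_measure => x Bx; split => //; exact: (BA _ is_ _ Bx).
apply: ih => // [j js|j js x Bx|j k js ks]; first exact/mB/ss.
  split; first exact: (BA _ (ss _ js)).
  move=> Bix; have ij : i <> j by move=> ij; rewrite ij js in i_s.
  by have := dB _ _ is_ (ss _ js) ij; rewrite -subset0; apply; split; eauto.
by apply: dB; exact: ss.
Qed.

Lemma outer_le_sum (T : eqType) (s : seq T) (B : T -> set X) (A : set X) :
  A `<=` \bigcup_(i in [set` s]) B i -> (mu A <= \sum_(i <- s) mu (B i))%E.
Proof.
move=> /(le_outer_measure mu)/le_trans; apply.
elim: s => [|i s ih].
  by rewrite set_nil bigcup_set0 outer_measure0 big_nil.
rewrite big_cons; apply: le_trans (leeD2l _ ih).
apply: le_trans (outer_measureU2 _ _ _); apply: le_outer_measure => x [j] /=.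
by rewrite inE => /predU1P[-> Bx|js Bx]; [left|right; exists j].
Qed.

(** Each piece takes at least the fraction [1 / K] of the measure of [A], so that
    there is room for at most [K] disjoint pieces. *)
Lemma packing_card_le (T : choiceType) (S : set T) (B : T -> set X)
    (A : set X) (K : R) (N : nat) :
  (forall i, S i -> mu.-caratheodory (B i)) ->
  (forall i, S i -> B i `<=` A) ->
  (forall i j, S i -> S j -> i <> j -> B i `&` B j = set0) ->
  (forall i, S i -> mu A <= K%:E * mu (B i))%E ->
  (0 < mu A)%E -> (mu A < +oo)%E -> 0 <= K -> K <= N%:R ->
  (S #<= `I_N)%card.
Proof.
move=> mB BA dB AB A0 Aoo K0 KN.
have key (F : {fset T}) : [set` F] `<=` S -> (#|` F| <= N)%N.
  move=> FS; rewrite -(ler_nat R); apply: le_trans KN.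
  have Afin : mu A \is a fin_num by rewrite ge0_fin_numE// ltW.
  have sB : (\sum_(i <- F) mu (B i) <= mu A)%E.
    apply: sum_outer_le => // [i /FS/mB//|i /FS/BA//|i j /FS Si /FS Sj].
    exact: dB.
  have : (\sum_(i <- F) mu A <= K%:E * mu A)%E.
    apply: (@le_trans _ _ (\sum_(i <- F) K%:E * mu (B i))%E).
      by rewrite !big_seq; apply: lee_sum => i /FS /AB.
    rewrite -ge0_sume_distrr ?lee_wpmul2l// => i _.
    exact: outer_measure_ge0.
  rewrite -(fineK Afin) sumEFin -EFinM lee_fin big_const_seq count_predT.
  by rewrite iter_addr_0 -[leLHS]mulr_natl ler_pM2r // fine_gt0 // A0.
have finS : finite_set S.
  apply: contrapT => /(infinite_set_fset N.+1)[F FS].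
  by rewrite ltnNge key.
have /finite_setP[n Sn] := finS.
rewrite (card_le_eql Sn) card_le_II -(card_fset_set Sn); apply: key.
by rewrite fset_setK.
Qed.

End OuterMeasure.

(** Continuity from above at the empty set, for the measure that [mu] induces on
    its Caratheodory sets. The case of an empty type is separate because
    measurable types are pointed. *)
Lemma outer_measure_cvg0 (R : realType) (X : choiceType)
    (mu : {outer_measure set X -> \bar R}) (W : (set X)^nat) :
  (forall n, mu.-caratheodory (W n)) ->
  {homo W : n m / (n <= m)%N >-> m `<=` n} ->
  (mu (W 0%N) < +oo)%E -> \bigcap_n W n = set0 ->
  mu (W n) @[n --> \oo] --> 0%E.
Proof.
elim/choicePpointed: X => X in mu W *.
  move=> _ _ _ _; rewrite (_ : (fun n => mu (W n)) = fun=> 0%E).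
    exact: cvg_cst.
  by apply/funext => n; rewrite [W n]emptyE outer_measure0.
move=> mW nW W0 capW; rewrite -(outer_measure0 mu) -capW.
have := @nonincreasing_cvg_mu _ (caratheodory_type mu) _ mu W.
apply=> //; first by rewrite capW; exact: measurable0.
by move=> m n mn; apply/subsetPset; exact: nW.
Qed.

(** * Doubling measures *)

Section Doubling.
Variables (R : realType) (X : choiceType) (A0 A1 : R).
Variables (rho : X -> X -> R) (mu : {outer_measure set X -> \bar R}).
Hypotheses (hA0 : 1 <= A0) (hA1 : 1 <= A1).
Hypothesis hX : homogeneous_type A0 A1 rho mu.

Let qm : quasi_metric A0 rho := ht_quasi_metric hX.
Let dm : doubling_measure A1 rho mu := ht_doubling hX.

Lemma rho_refl x : rho x x = 0.
Proof. exact/(qm_eq0 qm). Qed.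

Lemma qballC x y r : qball rho x r y -> qball rho y r x.
Proof. by rewrite /qball /= (qm_sym qm). Qed.

Lemma rho_triangle_lt x y z r s :
  rho x y < r -> rho y z < s -> rho x z < A0 * (r + s).
Proof.
move=> xy yz; apply: le_lt_trans (qm_triangle qm x y z) _.
by rewrite -mulrDr ltr_pM2l ?(lt_le_trans _ hA0)// ltrD.
Qed.

Lemma open_caratheodory (U : set X) :
  @open (qtop rho) U -> mu.-caratheodory U.
Proof.
move=> oU; apply: (borel_measurable (dm_borel_regular dm)).
exact: sub_sigma_algebra.
Qed.

Lemma mu_qball_expn n x r : 0 < r ->
  (mu (qball rho x (2 ^+ n * r)) <= (A1 ^+ n)%:E * mu (qball rho x r))%E.
Proof.
move=> r0; elim: n => [|n ih]; first by rewrite !expr0 mul1r mul1e.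
rewrite exprS -mulrA.
apply: le_trans (dm_doubling dm x _) _; first by rewrite mulr_gt0// exprn_gt0.
rewrite exprS EFinM -muleA lee_wpmul2l// lee_fin.
exact: le_trans hA1.
Qed.

(** All comparisons of measures go through this form of doubling: the set is
    fitted into a dyadic dilate of a ball that may have another centre. *)
Lemma mu_le_qball n (A : set X) x r : 0 < r ->
  A `<=` qball rho x (2 ^+ n * r) ->
  (mu A <= (A1 ^+ n)%:E * mu (qball rho x r))%E.
Proof.
move=> r0 /(le_outer_measure mu)/le_trans; apply; exact: mu_qball_expn.
Qed.

End Doubling.

(** * Boundary layers *)

(** It depends on the set [P] alone and on an absolute width, so that the width
    stays fixed when a cube is replaced by its children. *)
Definition layer (R : realType) (X : choiceType) (rho : X -> X -> R)
    (P : set X) (r : R) : set X :=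
  [set x | P x /\ (qdist rho x (~` qclosure rho P) <= r%:E)%E].

Lemma layer_subset (R : realType) (X : choiceType) (rho : X -> X -> R)
    (P P' : set X) (r : R) :
  P `<=` P' -> layer rho P' r `&` P `<=` layer rho P r.
Proof.
move=> PP' x [[_ xr] Px]; split => //; apply: le_trans xr.
apply: ereal_inf_le_tmp => _ [y ny <-]; exists y => //.
by move=> /(@closureS (qtop rho) _ _ PP').
Qed.

(** * The tree of cubes *)

Section Cubes.
Variables (R : realType) (X : choiceType) (A0 A1 delta a0 : R) (p : nat).
Variables (rho : X -> X -> R) (mu : {outer_measure set X -> \bar R}).
Variables (I : int -> Type) (z : forall k, I k -> X).
Variable prec : rel {k : int & I k}.
Hypotheses (hA0 : 1 <= A0) (hA1 : 1 <= A1).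
Hypothesis hX : homogeneous_type A0 A1 rho mu.
Hypothesis hadm : admissible A0 delta rho z prec.
Hypotheses (delta_gt0 : 0 < delta) (a0_gt0 : 0 < a0).
(* [delta_a0_small] makes meeting core balls comparable in the tree,
   [delta_small] puts a child of [Q] deep inside the core ball of [Q], and
   [p_large] lets the dilate by [2 ^ p] of the core ball of a child contain
   its parent. *)
Hypothesis delta_a0_small : 4 * A0 ^+ 3 * (delta + a0) <= 1.
Hypothesis delta_small : 8 * A0 ^+ 4 * delta <= a0.
Hypothesis p_large : 4 * A0 ^+ 3 <= 2 ^+ p * (a0 * delta).

Let qm : quasi_metric A0 rho := ht_quasi_metric hX.
Let dm : doubling_measure A1 rho mu := ht_doubling hX.

Local Notation Q := (dyadic_cube delta a0 rho z prec).
Local Notation node k a := (existT I k a).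

Let A0_gt0 : 0 < A0.
Proof. exact: lt_le_trans hA0. Qed.

Let A0X_ge1 n : 1 <= A0 ^+ n.
Proof. exact: exprn_ege1. Qed.

Let A0_leX n : A0 <= A0 ^+ n.+1.
Proof. by rewrite exprS ler_peMr// ltW. Qed.

Lemma double_A0_le1 e : 0 <= e -> e <= delta + a0 -> 2 * A0 * e <= 1.
Proof.
move=> e0 e_le; apply: le_trans delta_a0_small.
by rewrite ler_pM ?ler_pM ?ler_nat ?mulr_ge0// ltW.
Qed.

Lemma delta_a0_lt1 : delta < 1 /\ a0 < 1.
Proof.
have : delta + a0 <= 4 * A0 ^+ 3 * (delta + a0).
  rewrite ler_peMl ?addr_ge0 ?ltW//.
  by rewrite (le_lt_trans (A0X_ge1 3))// ltr_pMl ?ltr1n// exprn_gt0.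
move=> /le_trans/(_ delta_a0_small) h.
by split; apply: lt_le_trans h; rewrite (ltrDl, ltrDr).
Qed.

Let delta_lt1 : delta < 1 := proj1 delta_a0_lt1.
Let a0_lt1 : a0 < 1 := proj2 delta_a0_lt1.

Lemma scale_gt0 k : 0 < delta ^ k.
Proof. exact: exprz_gt0. Qed.

Lemma scaleD (k : int) (n : nat) : delta ^ (k + n%:Z) = delta ^ k * delta ^+ n.
Proof. by rewrite expfzDr ?gt_eqF. Qed.

Lemma scaleS (k : int) : delta ^ (k + 1) = delta * delta ^ k.
Proof. by rewrite (scaleD k 1) expr1 mulrC. Qed.

Lemma scale_le (k l : int) : k <= l -> delta ^ l <= delta ^ k.
Proof.
move=> /int_le_add[n ->].
by rewrite scaleD ger_pMr ?scale_gt0// exprn_ile1 ?ltW.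
Qed.

Lemma prec_unique k l (b : I l) (a a' : I k) :
  prec (node l b) (node k a) -> prec (node l b) (node k a') -> a = a'.
Proof.
move=> h h'; have [c [_ cu]] := adm_ancestor hadm b (adm_generation hadm h).
by rewrite -(cu _ h) -(cu _ h').
Qed.

Lemma prec_refl_eq k (a a' : I k) : prec (node k a) (node k a') -> a = a'.
Proof. by move=> h; exact: (prec_unique (adm_refl hadm (node k a)) h). Qed.

(** The ancestor of [b] in generation [k] is also the one of [q], hence [a]. *)
Lemma prec_comparable q k l (a : I k) (b : I l) : k <= l ->
  prec q (node l b) -> prec q (node k a) -> prec (node l b) (node k a).
Proof.
case: q => m c kl cb ca; have [a' [ba' _]] := adm_ancestor hadm b kl.
by rewrite (prec_unique ca (adm_trans hadm cb ba')).
Qed.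

Lemma prec_interpolate (k m l : int) (a : I k) (b : I l) : k <= m -> m <= l ->
  prec (node l b) (node k a) ->
  exists2 c : I m, prec (node l b) (node m c) & prec (node m c) (node k a).
Proof.
move=> km ml ba; have [c [bc _]] := adm_ancestor hadm b ml.
by exists c => //; exact: prec_comparable ba.
Qed.

(** The parent axioms are stated for the generations [k] and [k - 1]; here and in
    [near_parent] the generations are kept as variables linked by an equation, to
    avoid transporting indices along [k + 1 - 1 = k]. *)
Lemma parent_near (k l : int) (a : I k) (b : I l) : l = k + 1 ->
  prec (node l b) (node k a) -> rho (z b) (z a) < delta ^ k.
Proof.
move=> lk; have kl : k = l - 1 by rewrite lk addrK.
by subst k; exact: (adm_parent_near hadm).
Qed.

Lemma near_parent (k l : int) (a : I k) (b : I l) : l = k + 1 ->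
  rho (z b) (z a) < (2 * A0)^-1 * delta ^ k -> prec (node l b) (node k a).
Proof.
move=> lk; have kl : k = l - 1 by rewrite lk addrK.
by subst k; exact: (adm_near_parent hadm).
Qed.

(** By the quasi-triangle inequality a chain of parents costs at most
    [A0 * (delta ^ k + c)], where [c] bounds the part of the chain below
    generation [k + 1]. Since [2 * A0 * delta <= 1], the inductive bound gives
    [c <= delta ^ k], and the constant does not grow with the length. *)
Lemma prec_near (k l : int) (a : I k) (b : I l) :
  prec (node l b) (node k a) -> rho (z b) (z a) < 2 * A0 * delta ^ k.
Proof.
move=> ba; have [n lk] := int_le_add (adm_generation hadm ba).
elim: n k a ba lk => [|n ih] k a ba lk.
  rewrite addr0 in lk; subst l.
  by rewrite (prec_refl_eq ba) (rho_refl hX) !mulr_gt0// scale_gt0.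
have lk1 : l = k + 1 + n%:Z by rewrite lk -addrA.
have [||c bc ca] := @prec_interpolate k (k + 1) l a b _ _ ba.
- by rewrite lerDl.
- by rewrite lk1 lerDl.
have bc1 : rho (z b) (z c) < delta ^ k.
  apply: lt_le_trans (ih _ _ bc lk1) _.
  by rewrite scaleS mulrA ger_pMl ?scale_gt0// double_A0_le1 ?lerDl ?ltW.
have := rho_triangle_lt hA0 hX bc1 (parent_near erefl ca).
by congr (_ < _); ring.
Qed.

Lemma desc_ball_near (k l : int) (a : I k) (b : I l) y :
  prec (node l b) (node k a) -> rho (z b) y < a0 * delta ^ l ->
  rho (z a) y < 3 * A0 ^+ 2 * delta ^ k.
Proof.
move=> ba yb; have lk := scale_le (adm_generation hadm ba).
have yb' : rho (z b) y < A0 * delta ^ k.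
  apply: lt_le_trans yb _.
  apply: ler_pM => //; [exact: ltW|exact/ltW/scale_gt0|].
  exact: le_trans (ltW a0_lt1) hA0.
have ab : rho (z a) (z b) < 2 * A0 * delta ^ k.
  by rewrite (qm_sym qm) prec_near.
by have := rho_triangle_lt hA0 hX ab yb'; congr (_ < _); ring.
Qed.

Lemma cube_sub_ball k (a : I k) :
  Q a `<=` qball rho (z a) (3 * A0 ^+ 2 * delta ^ k).
Proof. by move=> y [[l b] /= ba yb]; exact: desc_ball_near yb. Qed.

Lemma ball_sub_cube k (a : I k) : qball rho (z a) (a0 * delta ^ k) `<=` Q a.
Proof. by move=> y ya; exists (node k a) => //=; exact: (adm_refl hadm). Qed.

Lemma cube_subset k l (a : I k) (b : I l) :
  prec (node l b) (node k a) -> Q b `<=` Q a.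
Proof.
by move=> ba y [q qb yq]; exists q => //=; exact: (adm_trans hadm _ ba).
Qed.

Lemma cube_open k (a : I k) : @open (qtop rho) (Q a).
Proof.
apply: bigcup_open => -[l b] _ /=; apply: (ht_ball_open hX).
by rewrite mulr_gt0 ?scale_gt0.
Qed.

Lemma cube_caratheodory k (a : I k) : mu.-caratheodory (Q a).
Proof. exact/(open_caratheodory hX)/cube_open. Qed.

(** The ancestor [c] of [b] one generation after [a] stays within
    [2 * A0 * delta ^ (k + 1)] of [z b], which is close to [z a]. So [z c] is
    closer to [z a] than [delta ^ k / (2 * A0)], and [a] is the parent of [c]. *)
Lemma core_meet (k l : int) (a : I k) (b : I l) y : k <= l ->
  rho (z a) y < a0 * delta ^ k -> rho (z b) y < a0 * delta ^ l ->
  prec (node l b) (node k a).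
Proof.
move=> kl ya yb.
have ab : rho (z b) (z a) < A0 * (2 * a0 * delta ^ k).
  have yb' : rho (z b) y < a0 * delta ^ k.
    by apply: lt_le_trans yb _; rewrite ler_pM2l// scale_le.
  rewrite (qm_sym qm) in ya.
  by have := rho_triangle_lt hA0 hX yb' ya; congr (_ < _); ring.
have small : A0 * (2 * A0 * delta ^ (k + 1) + A0 * (2 * a0 * delta ^ k))
    <= (2 * A0)^-1 * delta ^ k.
  rewrite scaleS -(ler_pM2l (_ : 0 < 2 * A0)) ?mulr_gt0//.
  rewrite mulVKf ?gt_eqF ?mulr_gt0//.
  rewrite [leLHS](_ : _ = 4 * A0 ^+ 3 * (delta + a0) * delta ^ k); last by ring.
  by rewrite ger_pMl ?scale_gt0.
(* In one generation the separation of the centres forces [a = b]. *)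
have [kl_eq|kl'] := eqVneq k l; first subst l.
  suff zba : z b = z a by rewrite (adm_inj hadm zba); exact: (adm_refl hadm).
  apply: contrapT => /((adm_maximal hadm k).1 _ _ (imageT _ _) (imageT _ _)).
  rewrite leNgt => /negP; apply; apply: lt_le_trans ab _.
  by rewrite !mulrA ger_pMl ?scale_gt0// (mulrC A0) double_A0_le1 ?lerDr ?ltW.
have kl1 : k + 1 <= l by rewrite lezD1 lt_neqAle kl' kl.
have [c [bc _]] := adm_ancestor hadm b kl1.
suff ca : prec (node (k + 1) c) (node k a) by exact: (adm_trans hadm bc ca).
apply: near_parent => //; apply: lt_le_trans small.
by apply: (rho_triangle_lt hA0 hX _ ab); rewrite (qm_sym qm) prec_near.
Qed.

(** A common point lies in core balls of descendants of [a] and of [b]. These are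
    comparable by [core_meet], so that one index lies below both [a] and [b]. *)
Lemma cube_meet (k l : int) (a : I k) (b : I l) y : k <= l ->
  Q b y -> Q a y -> prec (node l b) (node k a).
Proof.
move=> kl [[m c] /= cb yc] [[n d] /= da yd].
have [mn|/ltW nm] := leP m n.
  have dc := core_meet mn yc yd.
  exact: prec_comparable kl (adm_trans hadm dc cb) da.
have cd := core_meet nm yd yc.
exact: prec_comparable kl cb (adm_trans hadm cd da).
Qed.

(** The sets, and not the indices, are compared: cubes will be counted and summed
    over as elements of [set X], because the index types carry no structure. *)
Lemma cube_disjoint k (a a' : I k) : Q a <> Q a' -> Q a `&` Q a' = set0.
Proof.
move=> aa'; rewrite -subset0 => y [ya ya']; apply: aa'.
by rewrite (prec_refl_eq (cube_meet (lexx k) ya ya')).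
Qed.

Lemma center_in_cube k (a : I k) : Q a (z a).
Proof.
by apply: ball_sub_cube; rewrite /qball /= (rho_refl hX) mulr_gt0 ?scale_gt0.
Qed.

Lemma prec_of_subset k l (a : I k) (b : I l) : k <= l ->
  Q b `<=` Q a -> prec (node l b) (node k a).
Proof.
move=> kl ba.
exact: cube_meet kl (center_in_cube b) (ba _ (center_in_cube b)).
Qed.

Lemma cube_nested (k l : int) (a : I k) (b : I l) : k <= l ->
  Q b `<=` Q a \/ Q b `&` Q a = set0.
Proof.
move=> kl; have [ba0|/set0P[y [yb ya]]] := eqVneq (Q b `&` Q a) set0.
  by right.
by left; exact: cube_subset (cube_meet kl yb ya).
Qed.

Lemma cube_parent (k l : int) (a : I k) : l < k ->
  exists! b : I l, Q a `<=` Q b.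
Proof.
move=> lk; have [b [ab bu]] := adm_ancestor hadm a (ltW lk).
exists b; split; first exact: cube_subset ab.
by move=> b' /(prec_of_subset (ltW lk))/bu.
Qed.

Lemma cube_diam k (a : I k) :
  (qdiam rho (Q a) <= (6 * A0 ^+ 3 * delta ^ k)%:E)%E.
Proof.
apply: ge_ereal_sup => _ [x /cube_sub_ball ax] [y /cube_sub_ball ay] <-.
rewrite lee_fin ltW//; have := rho_triangle_lt hA0 hX (qballC hX ax) ay.
by congr (_ < _); ring.
Qed.

(** A point at distance at least [delta ^ k] from all centres could be added to
    them, against maximality. *)
Lemma center_dense k x : exists a : I k, rho x (z a) < delta ^ k.
Proof.
apply: contrapT => /forallNP far.
have sep (a : I k) : delta ^ k <= rho x (z a).
  by rewrite leNgt; apply/negP => h; exact: (far a).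
have [zsep zmax] := adm_maximal hadm k.
suff : (range (@z k) `|` [set x] = range (@z k)).
  move=> e; have : (range (@z k) `|` [set x]) x by right.
  rewrite e => -[a _ ax]; apply: (far a).
  by rewrite ax (rho_refl hX) scale_gt0.
apply: zmax; first exact: subsetUl.
move=> u v [zu|->] [zv|->] uv //; first exact: zsep.
- by case: zu => a _ <-; rewrite (qm_sym qm).
- by case: zv => a _ <-.
Qed.

Lemma cube_measure_pos k (a : I k) : (0 < mu (Q a))%E.
Proof.
apply: lt_le_trans (le_outer_measure mu _ _ (@ball_sub_cube k a)).
by apply: (dm_ball_gt0 dm); rewrite mulr_gt0 ?scale_gt0.
Qed.

Lemma cube_measure_fin k (a : I k) : (mu (Q a) < +oo)%E.
Proof.
apply: le_lt_trans (le_outer_measure mu _ _ (@cube_sub_ball k a)) _.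
by apply: (dm_ball_lty dm); rewrite !mulr_gt0 ?exprn_gt0 ?scale_gt0.
Qed.

(** The cube [Q a] lies in the ball of radius [4 * A0 ^ 3 * delta ^ k] about [z b],
    and so in the dilate by [2 ^ p] of the core ball of [b]. *)
Lemma child_measure k (a : I k) (b : I (k + 1)) :
  prec (node _ b) (node k a) -> (mu (Q a) <= (A1 ^+ p)%:E * mu (Q b))%E.
Proof.
move=> ba; have K0 : 0 <= A1 ^+ p by rewrite exprn_ge0// (le_trans _ hA1).
have core_le := le_outer_measure mu _ _ (@ball_sub_cube _ b).
apply: le_trans (lee_wpmul2l _ core_le) => //.
apply: (mu_le_qball hA1 hX); first by rewrite mulr_gt0 ?scale_gt0.
move=> y /cube_sub_ball ay; rewrite /qball /=.
apply: lt_le_trans (rho_triangle_lt hA0 hX (parent_near erefl ba) ay) _.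
apply: (@le_trans _ _ (4 * A0 ^+ 3 * delta ^ k)); last first.
  rewrite scaleS [leRHS](_ : _ = 2 ^+ p * (a0 * delta) * delta ^ k).
    by rewrite ler_pM2r ?scale_gt0.
  by ring.
rewrite [leLHS](_ : _ = (A0 + 3 * A0 ^+ 3) * delta ^ k); last by ring.
by rewrite ler_pM2r ?scale_gt0//; have := A0_leX 2; lra.
Qed.

Lemma children_card (k : int) (a : I k) N : A1 ^+ p <= N%:R ->
  ([set P | range (Q (k:=k + 1)) P /\ P `<=` Q a] #<= `I_N)%card.
Proof.
move=> KN.
apply: (@packing_card_le _ _ mu _ _ id (Q a) (A1 ^+ p) N) => //.
- by move=> P [[b _ <-] _]; exact: cube_caratheodory.
- by move=> P [].
- by move=> P P' [[b _ <-] _] [[b' _ <-] _]; exact: cube_disjoint.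
- move=> P [[b _ <-] ba]; apply: child_measure.
  by apply: prec_of_subset ba; rewrite lerDl.
- exact: cube_measure_pos.
- exact: cube_measure_fin.
- by rewrite exprn_ge0// (le_trans _ hA1).
Qed.

Lemma pow_p_a0 : 1 <= 2 ^+ p * a0.
Proof.
apply: (@le_trans _ _ (2 ^+ p * (a0 * delta))).
  by apply: le_trans p_large; have := A0X_ge1 3; lra.
by rewrite ler_pM2l ?exprn_gt0// ger_pMr// ltW.
Qed.

(** * The cubes of a generation cover almost everything *)

(** The bounded set [D] is covered by finitely many balls of radius [s n] about
    centres. Each has at most [A1 ^ p] times the measure of its core ball, and the
    core balls are disjoint subsets of [W n], the part outside [E] of a
    neighbourhood of [D]. *)
Lemma uncovered_bounded_null k x0 M : 0 < M ->
  mu ((~` \bigcup_(a in [set: I k]) Q a) `&` qball rho x0 M) = 0%E.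
Proof.
move=> M0; set E := ~` _; set D := E `&` _.
have oE : @open (qtop rho) (~` E).
  by rewrite setCK; apply: bigcup_open => a _; exact: cube_open.
pose s n := delta ^ (k + n%:Z).
have s0 n : 0 < s n by exact: scale_gt0.
have kkn n : k <= k + n%:Z by rewrite lerDl.
have s_le m n : (m <= n)%N -> s n <= s m.
  by move=> mn; rewrite scale_le// lerD2l.
pose V n := \bigcup_(y in D) qball rho y (2 * A0 * s n).
pose W n := V n `\` E.
have mW n : mu.-caratheodory (W n).
  apply: caratheodory_measurable_setI; apply: (open_caratheodory hX) => //.
  apply: bigcup_open => y _; apply: (ht_ball_open hX).
  by rewrite !mulr_gt0.
have W_noninc : {homo W : n m / (n <= m)%N >-> m `<=` n}.
  move=> m n mn; apply: setSD => x [y Dy yx]; exists y => //.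
  by apply: lt_le_trans yx _; rewrite ler_pM2l ?mulr_gt0// s_le.
pose M' := A0 * (M + 2 * A0 * s 0%N).
have M'0 : 0 < M' by rewrite mulr_gt0 ?addr_gt0 ?mulr_gt0.
have W0 : W 0%N `<=` qball rho x0 M'.
  by move=> x [[y [_ x0y] yx] _]; exact: (rho_triangle_lt hA0 hX x0y yx).
(* A point outside the closed set [E] has a positive distance to it. *)
have capW : \bigcap_n W n = set0.
  rewrite -subset0 => x Wx.
  have [r r0 xr] : exists2 r : R, 0 < r & qball rho x r `<=` ~` E.
    by apply: oE; have [] := Wx 0%N Logic.I.
  have [n nr] : exists n, 2 * A0 * s n < r.
    have [n] := exists_expr_lt (2 * A0 * delta ^ k) delta_gt0 delta_lt1 r0.
    by exists n; rewrite /s scaleD mulrA.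
  have [[y [Ey _] yx] _] := Wx n Logic.I.
  by apply: (xr y) Ey; apply: (qballC hX); exact: lt_trans nr.
have bound n : (mu D <= (A1 ^+ p)%:E * mu (W n))%E.
  pose S := [set c | range (@z (k + n%:Z)) c /\ exists2 y, D y & rho c y < s n].
  pose B c := qball rho c (a0 * s n).
  have BW c : S c -> B c `<=` W n.
    move=> [[a _ <-] [y Dy ay]] x ax; split.
      exists y => //; rewrite /qball /=.
      rewrite (qm_sym qm) in ay.
      apply: lt_le_trans (rho_triangle_lt hA0 hX ay ax) _.
      by rewrite (mulrC 2) -mulrA ler_pM2l// mulrDl mul1r lerD2l ger_pMl// ltW.
    apply; have [b [ab _]] := adm_ancestor hadm a (kkn n).
    exists b => //; apply: (cube_subset ab); exact: ball_sub_cube.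
  have B_disj c c' : S c -> S c' -> c <> c' -> B c `&` B c' = set0.
    move=> [[a _ <-] _] [[a' _ <-] _] aa'; rewrite -subset0 => x [xa xa'].
    by apply: aa'; rewrite (prec_refl_eq (core_meet (lexx _) xa xa')).
  have Bc c : mu.-caratheodory (B c).
    by apply: (dm_ball_measurable dm); rewrite mulr_gt0.
  (* This dilation depends on [n]; it only serves to show that [S] is finite. *)
  have [q qP] := exists_pow2_ge (2 * A0 * M') (mulr_gt0 a0_gt0 (s0 n)).
  have finS : finite_set S.
    apply/finite_set_leP; exists (Num.truncn (A1 ^+ q)).+1.
    apply: (@packing_card_le _ _ mu _ _ B (qball rho x0 M') (A1 ^+ q)) => //.
    - move=> c /BW/subset_trans; apply.
      by apply: subset_trans W0; exact: W_noninc.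
    - move=> c Sc; apply: (mu_le_qball hA1 hX); first by rewrite mulr_gt0.
      move=> x x0x.
      have x0c : rho c x0 < M'.
        apply: (qballC hX); apply: W0; apply: (W_noninc _ _ (leq0n n)).
        by apply: (BW _ Sc); rewrite /B /qball /= (rho_refl hX) mulr_gt0.
      apply: lt_le_trans (rho_triangle_lt hA0 hX x0c x0x) _.
      by apply: le_trans qP; rewrite -mulr2n -mulr_natl; lra.
    - exact: (dm_ball_gt0 dm).
    - exact: (dm_ball_lty dm).
    - by rewrite exprn_ge0// (le_trans _ hA1).
    - exact/ltW/truncnS_gt.
  have [t ut St] := finite_set_uniq_seq finS.
  have K0 : 0 <= A1 ^+ p by rewrite exprn_ge0// (le_trans _ hA1).
  apply: (@le_trans _ _ (\sum_(c <- t) mu (qball rho c (s n)))%E).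
    apply: outer_le_sum => x Dx; rewrite -St.
    have [a xa] := center_dense (k + n%:Z) x.
    exists (z a); last exact: (qballC hX).
    by split; [exists a|exists x => //; rewrite (qm_sym qm)].
  apply: (@le_trans _ _ (\sum_(c <- t) (A1 ^+ p)%:E * mu (B c))%E).
    apply: lee_sum => c _; apply: (mu_le_qball hA1 hX).
      by rewrite mulr_gt0.
    move=> x; rewrite /qball /= => /lt_le_trans; apply.
    by rewrite mulrA ler_peMl ?pow_p_a0 // ltW.
  rewrite -ge0_sume_distrr; last by move=> *; exact: outer_measure_ge0.
  apply: lee_wpmul2l => //; apply: sum_outer_le => // [c ct|c c' ct c't].
    by apply: BW; rewrite St.
  by apply: B_disj; rewrite St.
have W0_fin : (mu (W 0%N) < +oo)%E.
  exact: le_lt_trans (le_outer_measure mu _ _ W0) (dm_ball_lty dm x0 M'0).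
have W_cvg := outer_measure_cvg0 mW W_noninc W0_fin capW.
apply/eqP; rewrite eq_le outer_measure_ge0 andbT.
rewrite -(mule0 (A1 ^+ p)%:E).
apply: (cvge_ge _ (cvgeZl _ W_cvg)) => //; exact: nearW.
Qed.

Lemma uncovered_null k : mu (~` \bigcup_(a in [set: I k]) Q a) = 0%E.
Proof.
have [x0 _] := ht_nonempty hX.
set E := ~` _; apply/eqP; rewrite eq_le outer_measure_ge0 andbT.
have : E `<=` \bigcup_n (E `&` qball rho x0 n.+1%:R).
  move=> x Ex; exists (Num.truncn (rho x0 x)) => //; split => //.
  exact: truncnS_gt.
move=> /(le_outer_measure mu)/le_trans; apply.
apply: le_trans (outer_measure_sigma_subadditive _ _) _.
by rewrite eseries0// => n _ _; exact: uncovered_bounded_null.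
Qed.

(** * Decay of the boundary layers *)

(** The child [G] has its centre within [delta ^ (k + 1)] of [z a], and so every
    point of [G] is within [a0 * delta ^ k / (2 * A0)] of [z a]. A point within
    [2 * r] of [G] is then still in the core ball of [a], hence in [Q a]. *)
Lemma central_child k (a : I k) : exists g : I (k + 1),
  prec (node _ g) (node k a) /\
  forall r, 0 < r -> 4 * A0 * r <= a0 * delta ^ k ->
    layer rho (Q a) r `&` Q g = set0.
Proof.
have [g ag] := center_dense (k + 1) (z a).
exists g; split.
  apply: near_parent => //; rewrite (qm_sym qm); apply: lt_le_trans ag _.
  rewrite scaleS ler_pM2r ?scale_gt0// -[leRHS]mul1r ler_pdivlMr ?mulr_gt0//.
  by rewrite mulrC double_A0_le1 ?lerDl ?ltW.
move=> r r0 r_small; rewrite -subset0 => x [[_ xr] /cube_sub_ball gx].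
have [y ny xy] : exists2 y, (~` qclosure rho (Q a)) y & rho x y < 2 * r.
  have /(le_lt_trans xr)/ereal_inf_lt[_ [y ny <-]] : (r%:E < (2 * r)%:E)%E.
    by rewrite lte_fin ltr_pMl ?ltr1n.
  by rewrite lte_fin; exists y.
apply: ny; apply: (@subset_closure (qtop rho)); apply: ball_sub_cube.
have ax := rho_triangle_lt hA0 hX ag gx.
apply: lt_le_trans (rho_triangle_lt hA0 hX ax xy) _.
have hd : 8 * A0 ^+ 4 * delta ^ (k + 1) <= a0 * delta ^ k.
  by rewrite scaleS mulrA ler_pM2r ?scale_gt0.
have hA : A0 ^+ 2 * delta ^ (k + 1) <= A0 ^+ 4 * delta ^ (k + 1).
  by rewrite ler_pM2r ?scale_gt0// ler_weXn2l.
rewrite [leLHS](_ : _ = A0 ^+ 2 * delta ^ (k + 1)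
  + 3 * (A0 ^+ 4 * delta ^ (k + 1)) + 2 * A0 * r); last by ring.
lra.
Qed.

(** The central child, whose share of the measure is at least [1 / A1 ^ p], is
    discarded in each of the [n] generations. The factor [2] only makes the
    ratio positive when [A1 = 1]. *)
Lemma layer_decay n k (a : I k) r : 0 < r ->
  (forall i, (i < n)%N -> 4 * A0 * r <= a0 * delta ^ (k + i%:Z)) ->
  (mu (layer rho (Q a) r)
     <= ((1 - (2 * A1 ^+ p)^-1) ^+ n)%:E * mu (Q a))%E.
Proof.
move=> r0; set theta := 1 - _.
have A1X : 1 <= A1 ^+ p by exact: exprn_ege1.
have theta0 : 0 <= theta.
  by rewrite subr_ge0 invf_le1 ?mulr_gt0 ?(lt_le_trans _ A1X)//; lra.
elim: n k a => [|n ih] k a r_small.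
  by rewrite expr0 mul1e; apply: le_outer_measure => x [].
have [g [ga glayer]] := central_child a.
(* The children of [a] other than the central one. *)
pose F := [set P | range (Q (k:=k + 1)) P /\ P `<=` Q a] `\ Q g.
have F_disj P P' : F P -> F P' -> P <> P' -> P `&` P' = set0.
  by move=> [[[b _ <-] _] _] [[[b' _ <-] _] _]; exact: cube_disjoint.
have finF : finite_set F.
  apply: finite_setD; apply/finite_set_leP; exists (Num.truncn (A1 ^+ p)).+1.
  exact/children_card/ltW/truncnS_gt.
have [s us Fs] := finite_set_uniq_seq finF.
have inF P : P \in s -> F P by move=> Ps; rewrite Fs.
have sum_le : (\sum_(P <- s) mu P <= theta%:E * mu (Q a))%E.
  have : (\sum_(P <- Q g :: s) mu P <= mu (Q a))%E.
    apply: (@sum_outer_le _ _ mu _ _ id) => [|P|P|P P'].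
    - rewrite /= us andbT; apply/negP => /inF[_]; exact.
    - rewrite inE => /predU1P[->|/inF[[[b _ <-] _] _]];
        exact: cube_caratheodory.
    - by rewrite inE => /predU1P[->|/inF[[_]]//]; exact: cube_subset.
    - rewrite !inE => /predU1P[->|/inF FP] /predU1P[->|/inF FP'] //.
      + by move: FP' => [[[b _ <-] _] _]; exact: cube_disjoint.
      + by move: FP => [[[b _ <-] _] _]; exact: cube_disjoint.
      + exact: F_disj.
  rewrite big_cons.
  move: (child_measure ga) (cube_measure_fin a) (cube_measure_fin g).
  have : (0 <= \sum_(P <- s) mu P)%E.
    by apply: sume_ge0 => *; exact: outer_measure_ge0.
  move: (outer_measure_ge0 mu (Q a)) (outer_measure_ge0 mu (Q g)).
  case: (mu (Q a)) => // m; case: (mu (Q g)) => // h.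
  case: (\sum_(P <- s) _)%E => // t.
  rewrite -!EFinM -EFinD !lee_fin => m0 h0 t0 mh _ _ tm.
  have K0 : 0 < 2 * A1 ^+ p by lra.
  have : (2 * A1 ^+ p)^-1 * m <= h.
    by rewrite mulrC ler_pdivrMr//; nra.
  by rewrite /theta; lra.
have cover : layer rho (Q a) r `<=`
    (~` \bigcup_(b in [set: I (k + 1)]) Q b) `|`
    \bigcup_(P in [set` s]) layer rho P r.
  move=> x ax.
  have [[b _ bx]|] := pselect ((\bigcup_(b in [set: I (k + 1)]) Q b) x);
    last by left.
  right; exists (Q b); last first.
    apply: layer_subset (conj ax bx); apply: cube_subset.
    by apply: cube_meet bx ax.1; rewrite lerDl.
  rewrite -Fs; split; first split; first by exists b.
    by apply: cube_subset; apply: cube_meet bx ax.1; rewrite lerDl.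
  move=> bg; have : (layer rho (Q a) r `&` Q g) x by split => //; rewrite -bg.
  rewrite glayer//; have := r_small 0%N isT.
  by rewrite addr0.
apply: le_trans (le_outer_measure mu _ _ cover) _.
apply: le_trans (outer_measureU2 _ _ _) _.
rewrite uncovered_null add0e.
apply: (@le_trans _ _ (\sum_(P <- s) mu (layer rho P r))%E).
  exact: (@outer_le_sum _ _ mu _ s (fun P => layer rho P r)).
apply: (@le_trans _ _ (\sum_(P <- s) (theta ^+ n)%:E * mu P)%E).
  rewrite !big_seq; apply: lee_sum => P /inF[[[b _ <-] _] _].
  apply: ih => i i_n.
  have := r_small i.+1 i_n; congr (_ <= _ * _ ^ _).
  by rewrite intS addrA.
rewrite -ge0_sume_distrr; last by move=> *; exact: outer_measure_ge0.
by rewrite exprSr EFinM -muleA lee_wpmul2l// lee_fin exprn_ge0.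
Qed.

End Cubes.

(** * Choice of the constants *)

Theorem theorem3p6 (R : realType) (A0 A1 : R) (hA0 : 1 <= A0) (hA1 : 1 <= A1) :
  exists (delta a0 eta C1 C2 : R) (N0 : nat),
    [/\ 0 < delta < 1, 0 < a0 < 1, 0 < eta &
    forall (X : choiceType) (rho : X -> X -> R)
      (mu : {outer_measure set X -> \bar R}),
      homogeneous_type A0 A1 rho mu ->
    forall (I : int -> Type) (z : forall k : int, I k -> X)
      (le : rel {k : int & I k}),
      admissible A0 delta rho z le ->
    let Q : forall k : int, I k -> set X := dyadic_cube delta a0 rho z le in
    (* (a) *)
    (forall (k : int) (a : I k), @open (qtop rho) (Q k a)) /\
    (* (b) *)
    (forall (k : int) (a : I k), qball rho (z k a) (a0 * delta ^ k) `<=` Q k a) /\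
    (* (c) *)
    (forall (k : int) (a : I k), (qdiam rho (Q k a) <= (C1 * delta ^ k)%:E)%E) /\
    (* (d) *)
    (forall (k l : int) (a : I k), l < k ->
      exists! b : I l, Q k a `<=` Q l b) /\
    (* (e) *)
    (forall (k l : int) (a : I k) (b : I l), k <= l ->
      Q l b `<=` Q k a \/ Q l b `&` Q k a = set0) /\
    (* (f) *)
    (forall (k : int) (a : I k),
      ([set P | range (Q (k + 1)) P /\ P `<=` Q k a] #<= `I_N0)%card) /\
    (* (g) *)
    (forall k : int, mu (~` \bigcup_(a in [set: I k]) Q k a) = 0%E) /\
    (* (h) *)
    (forall (k : int) (a : I k) (t : R), 0 < t ->
      (mu [set x | Q k a x /\
             qdist rho x (~` qclosure rho (Q k a)) <= (t * delta ^ k)%:E]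
       <= (C2 * t `^ eta)%:E * mu (Q k a))%E)].
Proof.
have A0_gt0 : 0 < A0 by exact: lt_le_trans hA0.
have A0X n : 1 <= A0 ^+ n by exact: exprn_ege1.
(* [delta] turns [delta_small] into an equality; since [delta <= a0], the choice
   of [a0] gives [4 * A0 ^ 3 * (delta + a0) <= 8 * A0 ^ 3 * a0 = 1]. *)
pose a0 := (8 * A0 ^+ 3)^-1; pose delta := a0 / (8 * A0 ^+ 4).
have a0_gt0 : 0 < a0 by rewrite invr_gt0 mulr_gt0 ?exprn_gt0.
have delta_gt0 : 0 < delta by rewrite divr_gt0 ?mulr_gt0 ?exprn_gt0.
have delta_small : 8 * A0 ^+ 4 * delta <= a0.
  by rewrite mulrC divfK// gt_eqF// mulr_gt0 ?exprn_gt0.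
have delta_a0_small : 4 * A0 ^+ 3 * (delta + a0) <= 1.
  have a0E : 8 * A0 ^+ 3 * a0 = 1.
    by rewrite mulfV// gt_eqF// mulr_gt0 ?exprn_gt0.
  have : delta <= a0.
    rewrite ler_pdivrMr ?mulr_gt0 ?exprn_gt0// ler_peMr ?(ltW a0_gt0)//.
    by have := A0X 4%N; lra.
  have := A0X 3%N; nra.
have [delta_lt1 a0_lt1] := delta_a0_lt1 hA0 delta_gt0 a0_gt0 delta_a0_small.
have [p p_large] := exists_pow2_ge (4 * A0 ^+ 3) (mulr_gt0 a0_gt0 delta_gt0).
have K_ge1 : 1 <= A1 ^+ p by exact: exprn_ege1.
pose theta := 1 - (2 * A1 ^+ p)^-1.
have theta_bounds : 0 < theta < 1.
  rewrite subr_gt0 invf_lt1 ?gtrBl ?invr_gt0 ?mulr_gt0 ?(lt_le_trans _ K_ge1)//.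
  by rewrite andbT; lra.
have [eta eta_gt0 eta_pow] : exists2 eta : R, 0 < eta &
    forall n x, delta ^+ n <= x -> theta ^+ n <= x `^ eta.
  by case/andP: theta_bounds => *; exact: exponent_of_ratio.
pose c := a0 / (4 * A0).
have c_gt0 : 0 < c by rewrite divr_gt0 ?mulr_gt0.
exists delta, a0, eta, (6 * A0 ^+ 3), (c^-1 `^ eta), (Num.truncn (A1 ^+ p)).+1.
split; [by rewrite delta_gt0|by rewrite a0_gt0|by []|].
move=> X rho mu hX I z prec hadm Q.
split; first by move=> k a; exact: (cube_open hX).
split; first by move=> k a; exact: (ball_sub_cube hadm).
split; first by move=> k a; exact: (cube_diam hA0 hX hadm).
split; first by move=> k l a; exact: (cube_parent hA0 hX hadm).
split; first by move=> k l a b; exact: (cube_nested hA0 hX hadm).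
split.
  move=> k a; apply: (children_card hA0 hA1 hX hadm _ _ _ p_large) => //.
  exact/ltW/truncnS_gt.
split; first by move=> k; exact: (uncovered_null hA0 hA1 hX hadm _ _ _ p_large).
move=> k a t t_gt0.
(* The least [n] with [c * delta ^ n < t] is the number of generations on which
   the layer avoids the central children. *)
have ex_n : exists n, c * delta ^+ n < t by exact: exists_expr_lt.
case: (ex_minnP ex_n) => n n_lt n_min.
have dk_gt0 : 0 < delta ^ k by exact: exprz_gt0.
apply: (@le_trans _ _ ((theta ^+ n)%:E * mu (Q k a))%E).
  apply: (layer_decay hA0 hA1 hX hadm _ _ _ _ p_large) => // [|i i_n].
    exact: mulr_gt0.
  have : t <= c * delta ^+ i.
    by rewrite leNgt; apply/negP => /n_min; rewrite leqNgt i_n.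
  rewrite /c mulrAC ler_pdivlMr ?mulr_gt0// -(ler_pM2r dk_gt0).
  by rewrite (scaleD delta_gt0); congr (_ <= _); ring.
rewrite lee_wpmul2r ?outer_measure_ge0// lee_fin.
rewrite -powRM ?invr_ge0 ?(ltW c_gt0) ?(ltW t_gt0)//.
by apply: eta_pow; rewrite ler_pdivlMl// ltW.
Qed.
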